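(* Let the data set $P=\{(x_i,\vec y_i):i=0,\dots,n\}\subset\mathbb R^3$ and the recurrent iterated function system $\{\mathbb R^3;M;\vec W_i,\ i=1,\dots,n\}$ be as described in the context, with $\overline S<1$, and let $A$ be its attractor. Then there is a continuous function $\vec f:I\to\mathbb R^2$ that interpolates $P$, i.e. $\vec f(x_i)=\vec y_i$ for $i=0,1,\dots,n$, and whose graph $\{(x,\vec f(x)):x\in I\}$ is equal to $A$.
   Context: Data: $P=\{(x_i,\vec y_i)\in\mathbb R^3: i=0,1,\dots,n\}$ with $-\infty<x_0<x_1<\dots<x_n<\infty$ and $\vec y_i=(y_i,z_i)\in\mathbb R^2$ (the $y_i$ are given data values, the $z_i$ are arbitrary real parameters). Put $I=[x_0,x_n]$ and $I_i=[x_{i-1},x_i]$ for $i=1,\dots,n$ (the ''regions''). Domains: $l$ is an integer with $2\le l\le n$. For $k=1,\dots,l$, $\tilde I_k=[x_{s(k)},x_{e(k)}]\subset I$ is a subinterval (a ''domain'') with $s(k),e(k)\in\{0,\dots,n\}$ and $e(k)-s(k)\ge 2$. For each $i\in\{1,\dots,n\}$ an index $k=\gamma(i)\in\{1,\dots,l\}$ is chosen; below $k$ always means $\gamma(i)$. Maps $L_{i,k}$: $L_{i,k}:\tilde I_k\to I_i$ is a contraction homeomorphism (a homeomorphism that is Lipschitz with constant less than 1) with $L_{i,k}(\{x_{s(k)},x_{e(k)}\})=\{x_{i-1},x_i\}$. Maps $\vec F_{i,k}$: for $i=1,\dots,n$, $\vec F_{i,k}:\tilde I_k\times\mathbb R^2\to\mathbb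 R^2$ is defined, for $\vec y=(y,z)$, by $$\vec F_{i,k}(x,\vec y)=\begin{pmatrix} s_i(L_{i,k}(x))\,y+s_i'(L_{i,k}(x))\,z+q_{i,k}(x)\\ \tilde s_i(L_{i,k}(x))\,y+\tilde s_i'(L_{i,k}(x))\,z+\tilde q_{i,k}(x)\end{pmatrix},$$ where $s_i,s_i',\tilde s_i,\tilde s_i':I_i\to\mathbb R$ are Lipschitz functions whose absolute values are less than 1 (here $'$ is only a label, not a derivative), and $q_{i,k},\tilde q_{i,k}:\tilde I_k\to\mathbb R$ are Lipschitz functions such that: whenever $\alpha\in\{s(k),e(k)\}$, $a\in\{i-1,i\}$ and $L_{i,k}(x_\alpha)=x_a$, one has $\vec F_{i,k}(x_\alpha,\vec y_\alpha)=\vec y_a$. Transformations: $\vec W_i(x,\vec y)=(L_{i,k}(x),\vec F_{i,k}(x,\vec y))$ for $x\in\tilde I_k$, $\vec y\in\mathbb R^2$, with values in $I_i\times\mathbb R^2$. Constant $\overline S$: for a function $f$, $\overline f=\max_x|f(x)|$ over the domain of $f$, and $\overline S=\max\{\overline{s}_i+\overline{\tilde s}_i,\ \overline{s'}_i+\overline{\tilde s'}_i: i=1,\dots,n\}$. Matrix: $M=(p_{st})_{n\times n}$ with $p_{st}=1/a_s$ if $I_s\subseteq\tilde I_{\gamma(t)}$ and $p_{st}=0$ otherwise, where $a_s$ is the number of domains $\tilde I_k$ containing the region $I_s$. Thus $p_{st}>0$ exactly when $I_s\subseteq\tilde I_{\gamma(t)}$. Attractor of the recurrent iterated function system $\{\mathbb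 R^3;M;\vec W_i,\ i=1,\dots,n\}$: the set $A=\bigcup_{t=1}^n A_t$, where $(A_1,\dots,A_n)$ is the unique $n$-tuple of nonempty compact sets $A_t\subset I_t\times\mathbb R^2$ satisfying $A_t=\bigcup_{s:\,p_{st}>0}\vec W_t(A_s)$ for $t=1,\dots,n$. *)

(* Defs.v *)
From HB Require Import structures.
From mathcomp Require Import all_boot all_order all_algebra.
From mathcomp Require Import all_classical all_reals all_analysis.

Set Implicit Arguments.
Unset Strict Implicit.
Unset Printing Implicit Defensive.

Import Order.TTheory GRing.Theory Num.Theory.
Import numFieldNormedType.Exports.

Local Open Scope classical_set_scope.
Local Open Scope ring_scope.

Definition homeomorphism_between (T U : topologicalType) (A : set T) (B : set U)
    (f : T -> U) : Prop :=
  [/\ set_bij A B f, {within A, continuous f} &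
      exists2 g : U -> T, {in A, cancel f g} & {within B, continuous g}].

Definition contraction_on (R : realType) (A : set R) (f : R -> R) : Prop :=
  exists2 c : R, c < 1 & c.-lipschitz_A f.

(* For a continuous f on a nonempty compact A the supremum is a maximum. *)
Definition max_abs (R : realType) (A : set R) (f : R -> R) : R :=
  sup [set `|f t| | t in A].

(* Indices: the n regions are numbered by 'I_n, i : 'I_n standing for the
   region usually numbered i + 1, with endpoints x_i and x_{i+1}; the l domains
   are numbered by 'I_l.  All maps are total functions; only their values on
   the intended region or domain matter.  The second index of L, q and q' is
   always gam i and is therefore omitted. *)
Record rfif_data (R : realType) (n l : nat) := RfifData {
  absc : 'I_n.+1 -> R;
  ordi : 'I_n.+1 -> R * R;
  dom_start : 'I_l -> 'I_n.+1;
  dom_end : 'I_l -> 'I_n.+1;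
  gam : 'I_n -> 'I_l;
  mapL : 'I_n -> R -> R;
  (* the entries of the scaling matrix (s_i, s_i'; s~_i, s~_i') *)
  scal : 'I_n -> R -> R;
  scal' : 'I_n -> R -> R;
  tscal : 'I_n -> R -> R;
  tscal' : 'I_n -> R -> R;
  qmap : 'I_n -> R -> R;
  tqmap : 'I_n -> R -> R
}.

Section RFIF.
Context {R : realType} {n l : nat} (D : rfif_data R n l).

Definition left_idx (i : 'I_n) : 'I_n.+1 := widen_ord (leqnSn n) i.
Definition right_idx (i : 'I_n) : 'I_n.+1 := lift ord0 i.

Definition whole : set R := `[absc D ord0, absc D ord_max]%classic.

Definition region (i : 'I_n) : set R :=
  `[absc D (left_idx i), absc D (right_idx i)]%classic.

Definition domain (k : 'I_l) : set R :=
  `[absc D (dom_start D k), absc D (dom_end D k)]%classic.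

Definition mapF (i : 'I_n) (t : R) (v : R * R) : R * R :=
  let u := mapL D i t in
  (scal D i u * v.1 + scal' D i u * v.2 + qmap D i t,
   tscal D i u * v.1 + tscal' D i u * v.2 + tqmap D i t).

Definition mapW (i : 'I_n) (p : R * (R * R)) : R * (R * R) :=
  (mapL D i p.1, mapF i p.1 p.2).

Definition Sbar : R :=
  \big[Num.max/0]_(i < n)
    Num.max (max_abs (region i) (scal D i) + max_abs (region i) (tscal D i))
            (max_abs (region i) (scal' D i) + max_abs (region i) (tscal' D i)).

Definition num_domains (s : 'I_n) : nat :=
  #|[set k : 'I_l | `[< region s `<=` domain k >]]|.

Definition connection : 'M[R]_n :=
  \matrix_(s < n, t < n)
    if `[< region s `<=` domain (gam D t) >] then (num_domains s)%:R^-1 else 0.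

Record rfif_hyps : Prop := RfifHyps {
  absc_incr : forall i j : 'I_n.+1, (i < j)%N -> absc D i < absc D j;
  num_domains_bounds : (2 <= l <= n)%N;
  dom_size : forall k : 'I_l, (dom_start D k + 2 <= dom_end D k)%N;
  mapL_homeo : forall i : 'I_n,
    homeomorphism_between (domain (gam D i)) (region i) (mapL D i);
  mapL_contraction : forall i : 'I_n,
    contraction_on (domain (gam D i)) (mapL D i);
  mapL_endpoints : forall i : 'I_n,
    mapL D i @` [set absc D (dom_start D (gam D i));
                     absc D (dom_end D (gam D i))]
    = [set absc D (left_idx i); absc D (right_idx i)];
  scalings_lipschitz : forall i : 'I_n,
    [/\ [lipschitz scal D i t | t in region i],
        [lipschitz scal' D i t | t in region i],
        [lipschitz tscal D i t | t in region i] &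
        [lipschitz tscal' D i t | t in region i]];
  scalings_lt1 : forall (i : 'I_n) (t : R), region i t ->
    [/\ `|scal D i t| < 1, `|scal' D i t| < 1,
        `|tscal D i t| < 1 & `|tscal' D i t| < 1];
  qmaps_lipschitz : forall i : 'I_n,
    [lipschitz qmap D i t | t in domain (gam D i)] /\
    [lipschitz tqmap D i t | t in domain (gam D i)];
  mapF_joinup : forall (i : 'I_n) (al a : 'I_n.+1),
    al = dom_start D (gam D i) \/ al = dom_end D (gam D i) ->
    a = left_idx i \/ a = right_idx i ->
    mapL D i (absc D al) = absc D a ->
    mapF i (absc D al) (ordi D al) = ordi D a
}.

Definition invariant_tuple (A : 'I_n -> set (R * (R * R))) : Prop :=
  forall t : 'I_n,
    [/\ A t !=set0, compact (A t), A t `<=` region t `*` setT &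
        A t = \bigcup_(s in [set s : 'I_n | 0 < connection s t])
                (mapW t @` A s)].

(* Definite description: the unique invariant tuple.  If existence or
   uniqueness failed, this would be the constantly empty tuple. *)
Definition attractor_tuple : 'I_n -> set (R * (R * R)) :=
  xget (fun=> set0) [set A | unique invariant_tuple A].

Definition attractor : set (R * (R * R)) := \bigcup_(t : 'I_n) attractor_tuple t.

End RFIF.

Definition graph_on (T U : Type) (A : set T) (f : T -> U) : set (T * U) :=
  [set (t, f t) | t in A].

(* Main.v *)
Require Import Defs.
From HB Require Import structures.
From mathcomp Require Import all_boot all_order all_algebra.
From mathcomp Require Import all_classical all_reals all_analysis.
From mathcomp Require Import ring lra.

Set Implicit Arguments.
Unset Strict Implicit.
Unset Printing Implicit Defensive.

Import Order.TTheory GRing.Theory Num.Theory.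
Import numFieldNormedType.Exports.
Local Open Scope classical_set_scope.
Local Open Scope ring_scope.

(** The interpolant is the fixed point of the Read-Bajraktarevic operator, which
    sends [g] to the function taking the value [F_i(u, g u)] at [L_i u].  On
    functions interpolating the data this is well defined, two regions meeting
    only in a data point, and it preserves continuity; in the sup norm built on
    the 1-norm of the plane it is a contraction of ratio [Sbar].  Iterating it
    from a Lagrange polynomial yields a continuous interpolant [f] with
    [f (L_i u) = F_i (u, f u)], whose graph pieces over the regions form an
    invariant tuple.

    For any invariant tuple [A], the vertical distance from a point of [A t] to
    the graph of [f] is at most [Sbar^m * E] for all [m], so [A t] lies in the
    graph; and the points of a region are within [c^m * W] of the projection of
    [A t], [c] being a common contraction ratio of the [L_i], so this closed
    projection is the whole region.  Hence the invariant tuple is unique. *)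

(** * Continuity relative to a subset *)

Lemma within_continuous_compW {T U V : topologicalType} (A : set T) (B : set U)
    (f : T -> U) (g : U -> V) :
  (forall x, A x -> B (f x)) ->
  {within A, continuous f} -> {within B, continuous g} ->
  {within A, continuous (g \o f)}.
Proof.
move=> AB /subspace_continuousP cf /subspace_continuousP cg.
apply/subspace_continuousP => x Ax P gP.
have : \forall y \near within A (nbhs x), B (f y) -> P (g (f y)).
  exact: (cf _ Ax _ (cg _ (AB _ Ax) _ gP)).
rewrite !near_withinE /=; apply: filterS => y /[swap] Ay /(_ Ay); apply.
exact: AB.
Qed.

Lemma within_continuous_pair {T U V : topologicalType} (A : set T)
    (f : T -> U) (g : T -> V) :
  {within A, continuous f} -> {within A, continuous g} ->
  {within A, continuous (fun x => (f x, g x))}.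
Proof. by move=> cf cg x; apply: cvg_pair; [exact: cf|exact: cg]. Qed.

Lemma within_continuous_fst {T U V : topologicalType} (A : set T)
    (f : T -> U * V) :
  {within A, continuous f} -> {within A, continuous (fun x => (f x).1)}.
Proof. by move=> cf x; apply: cvg_comp (cf x) _; exact: cvg_fst. Qed.

Lemma within_continuous_snd {T U V : topologicalType} (A : set T)
    (f : T -> U * V) :
  {within A, continuous f} -> {within A, continuous (fun x => (f x).2)}.
Proof. by move=> cf x; apply: cvg_comp (cf x) _; exact: cvg_snd. Qed.

(** Finite pasting lemma: induction over the index list, carrying along the closedness of the
    partial unions, which gluing two pieces requires. *)
Lemma within_continuous_bigcup {T U : topologicalType} {I : finType}
    (F : I -> set T) (f : T -> U) :
  (forall i, closed (F i)) -> (forall i, {within F i, continuous f}) ->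
  {within \bigcup_i F i, continuous f}.
Proof.
move=> clF cf.
suff [_ cU] : closed (\big[setU/set0]_(i <- enum I) F i) /\
    {within \big[setU/set0]_(i <- enum I) F i, continuous f}.
  apply: continuous_subspaceW cU => x [i _ Fix].
  by rewrite -bigcup_seq; exists i => //=; rewrite mem_enum.
elim: (enum I) => [|i s [cls cs]].
  by rewrite big_nil; split; [exact: closed0|exact: continuous_subspace0].
by rewrite big_cons; split; [exact: closedU|exact: withinU_continuous].
Qed.

Lemma within_continuous_uniform_limit {R : realType} {T : topologicalType}
    (A : set T) (u : nat -> T -> R) (f : T -> R) :
  (forall m, {within A, continuous (u m)}) ->
  (forall e : R, 0 < e -> exists m, forall x, A x -> `|u m x - f x| <= e) ->
  {within A, continuous f}.
Proof.
move=> cu uf; apply/subspace_continuousP => x Ax.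
(* Three errors of at most [e / 4] (two from the uniform approximation, one from the continuity of
   [u m]) stay strictly below [e]. *)
apply/cvgrPdist_lt => e e0; have e3 : 0 < e / 4 by rewrite divr_gt0.
have [m um] := uf _ e3.
have /subspace_continuousP/(_ _ Ax)/cvgrPdist_lt/(_ _ e3) := cu m.
rewrite !near_withinE; apply: filterS => y /[swap] Ay /(_ Ay) uxy.
move: (um x Ax) (um y Ay) uxy; rewrite !ler_norml !ltr_norml.
rewrite /from_subspace => /andP[? ?] /andP[? ?] /andP[? ?];
  by apply/andP; split; lra.
Qed.

Lemma lipschitz_within_continuous {R : realType} (A : set R) (f : R -> R) :
  [lipschitz f x | x in A] -> {within A, continuous f}.
Proof.
move=> /pinfty_ex_gt0[k k0 /= kf]; apply/subspace_continuousP => x Ax.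
apply/cvgrPdist_lt => e e0; rewrite near_withinE.
have ek : 0 < e / k by rewrite divr_gt0.
have /cvgrPdist_lt/(_ _ ek) : y @[y --> x] --> x by exact: cvg_id.
apply: filterS => y xy Ay.
by rewrite (le_lt_trans (kf (x, y) (conj Ax Ay)))//= mulrC -ltr_pdivlMr.
Qed.

Lemma within_continuous_bounded {R : realType} (f : R -> R) (a b : R) :
  {within `[a, b], continuous f} ->
  exists M, forall x, `[a, b]%classic x -> `|f x| <= M.
Proof.
move=> cf.
have /compact_bounded[M [_ MB]] :=
  continuous_compact cf (@segment_compact _ a b).
by exists (M + 1) => x abx; apply: (MB (M + 1)); [rewrite ltrDl|exists x].
Qed.

(** * Geometric estimates and polynomial interpolation *)

Lemma ger0_geometric_le0 {R : realType} (a c E : R) :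
  0 <= c -> c < 1 -> (forall m, a <= c ^+ m * E) -> a <= 0.
Proof.
move=> c0 c1 aE; apply: (@cvgr_to_ge _ \oo _ _ (geometric E c)).
  by apply: cvg_geometric; rewrite ger0_norm.
by apply: nearW => m; rewrite /= mulrC.
Qed.

Lemma geometric_increments_limit {R : realType} (u : R ^nat) (K c : R) :
  0 <= c -> c < 1 -> (forall m, `|u m.+1 - u m| <= K * c ^+ m) ->
  cvgn u /\ forall m, `|u m - limn u| <= K / (1 - c) * c ^+ m.
Proof.
move=> c0 c1 uK; have d0 : 0 < 1 - c by rewrite subr_gt0.
have K0 : 0 <= K by have := le_trans (normr_ge0 _) (uK 0%N); rewrite expr0 mulr1.
(* The exact partial geometric sum is kept on the right: the cruder bound [ub] would not pass
   through the induction on [p]. *)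
have uinc m p : `|u m - u (m + p)%N| <= K / (1 - c) * (c ^+ m - c ^+ (m + p)).
  elim: p => [|p ih]; first by rewrite addn0 !subrr normr0 mulr0.
  rewrite (le_trans (ler_distD (u (m + p)%N) _ _))// addnS.
  rewrite distrC in ih; rewrite distrC.
  apply: le_trans (lerD ih _) _; first by rewrite distrC; exact: uK.
  by rewrite exprS le_eqVlt; apply/orP; left; apply/eqP; field; rewrite gt_eqF.
have ub m p : `|u m - u (m + p)%N| <= K / (1 - c) * c ^+ m.
  rewrite (le_trans (uinc m p))// ler_wpM2l ?divr_ge0 ?(ltW d0)//.
  by rewrite gerBl exprn_ge0.
have cu : cvgn u.
  apply/cauchy_cvgP/cauchy_exP => e e0.
  have /cvgrPdist_lt/(_ _ e0) : geometric (K / (1 - c)) c @ \oo --> (0 : R).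
    by apply: cvg_geometric; rewrite ger0_norm.
  move=> [N _ /(_ N (leqnn N))]; rewrite /= sub0r normrN => KN.
  exists (u N); exists N => // m /= Nm; rewrite -ball_normE /=.
  by rewrite -(subnKC Nm) (le_lt_trans (ub _ _))// (le_lt_trans (ler_norm _)).
split=> // m.
have cd : `|u m - u p| @[p --> \oo] --> `|u m - limn u|.
  by apply: cvg_norm; apply: cvgB; [exact: cvg_cst|exact: cu].
apply: (cvgr_to_le cd); exists m => // p /= mp.
by rewrite -(subnKC mp); exact: ub.
Qed.

(** Lagrange's formula, with [q i] the unnormalised basis polynomial at the node [x i]; injectivity
    makes the denominators nonzero. It supplies the starting point of the iteration. *)
Lemma interpolating_poly {R : fieldType} {n : nat} (x y : 'I_n -> R) :
  injective x -> exists p : {poly R}, forall i, p.[x i] = y i.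
Proof.
move=> xI; pose q i := \prod_(j < n | j != i) ('X - (x j)%:P).
exists (\sum_i (y i / (q i).[x i]) *: q i) => j.
have qN i : (q i).[x i] != 0.
  rewrite horner_prod; apply/prodf_neq0 => k ki.
  by rewrite hornerXsubC subr_eq0 inj_eq// eq_sym.
rewrite horner_sum (bigD1 j)//= hornerZ divfK// big1 ?addr0// => i ij.
rewrite hornerZ [X in _ * X]horner_prod (bigD1 j) 1?eq_sym//=.
by rewrite hornerXsubC subrr mul0r mulr0.
Qed.

(** * Nodes, regions and domains *)

Section RecurrentFractalInterpolation.
Context {R : realType} {n l : nat} (D : rfif_data R n l) (hD : rfif_hyps D).

Local Notation X := (absc D).
Local Notation dom i := (domain D (gam D i)).

Lemma n_gt0 : (0 < n)%N.
Proof.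
have /andP[l2 ln] := num_domains_bounds hD.
by apply: leq_trans ln; exact: leq_trans l2.
Qed.

Lemma absc_mono : {mono X : i j / (i <= j)%N >-> i <= j}.
Proof.
move=> i j; have [ij|ji] := leqP i j; last first.
  by apply/negbTE; rewrite -ltNge; exact: absc_incr.
move: ij; rewrite leq_eqVlt => /predU1P[/val_inj ->|/(absc_incr hD)/ltW//].
exact: lexx.
Qed.

Lemma absc_inj : injective X.
Proof.
by move=> i j ij; apply/val_inj/eqP; rewrite eqn_leq -!absc_mono ij lexx.
Qed.

Lemma regionP i x : region D i x <-> X (left_idx i) <= x <= X (right_idx i).
Proof. by rewrite /region /= in_itv. Qed.

Lemma domP k x : domain D k x <-> X (dom_start D k) <= x <= X (dom_end D k).
Proof. by rewrite /domain /= in_itv. Qed.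

Lemma wholeP x : whole D x <-> X ord0 <= x <= X ord_max.
Proof. by rewrite /whole /= in_itv. Qed.

Lemma domain_whole k : domain D k `<=` whole D.
Proof.
move=> x /domP/andP[sx xe]; apply/wholeP; apply/andP; split.
  by apply: le_trans sx; rewrite absc_mono.
by apply: (le_trans xe); rewrite absc_mono -ltnS.
Qed.

Lemma region_whole i : region D i `<=` whole D.
Proof.
move=> x /regionP/andP[sx xe]; apply/wholeP; apply/andP; split.
  by apply: le_trans sx; rewrite absc_mono.
by apply: (le_trans xe); rewrite absc_mono -ltnS.
Qed.

Lemma region_cover (a b : 'I_n.+1) x : (a < b)%N -> X a <= x <= X b ->
  exists s : 'I_n, [/\ (a <= s)%N, (s < b)%N & region D s x].
Proof.
move=> ab /andP[ax xb]; pose P (i : 'I_n.+1) := (i < b)%N && (X i <= x).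
have Pa : P a by rewrite /P ab.
(* [s] is the last index before [b] whose node is at most [x]. The next node is then at least [x]:
   either its index has reached [b], or maximality of [s] applies. *)
case: (@arg_maxnP _ a P val Pa) => s /andP[sb sx] smax.
have sn : (s < n)%N by rewrite (leq_trans sb)// -ltnS.
exists (Ordinal sn); split => //; first exact: smax.
apply/regionP; have -> : left_idx (Ordinal sn) = s by exact/val_inj.
rewrite sx /=; set r := right_idx _.
have [rb|br] := ltnP r b; last first.
  by rewrite (le_trans xb)// absc_mono.
rewrite leNgt; apply/negP => /ltW rx; have := smax r.
rewrite /P rb rx => /(_ isT) rs.
by have : (s.+1 <= s)%N := rs; rewrite ltnn.
Qed.

Lemma region_sub_domain (s : 'I_n) k :
  (dom_start D k <= s)%N -> (s < dom_end D k)%N -> region D s `<=` domain D k.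
Proof.
move=> ks sk x /regionP/andP[sx xs]; apply/domP; apply/andP; split.
  by apply: le_trans sx; rewrite absc_mono.
by apply: (le_trans xs); rewrite absc_mono.
Qed.

Lemma domain_cover k x : domain D k x ->
  exists2 s, region D s `<=` domain D k & region D s x.
Proof.
move=> /domP kx; have se : (dom_start D k < dom_end D k)%N.
  by apply: leq_trans (dom_size hD k); rewrite addn2.
have [s [ks sk sx]] := region_cover se kx.
by exists s => //; exact: region_sub_domain.
Qed.

Lemma whole_cover x : whole D x -> exists s, region D s x.
Proof.
by move=> /wholeP /region_cover -/(_ n_gt0) [s [_ _ sx]]; exists s.
Qed.

(** A nonzero entry is the inverse of a positive count, since the domain [gam D t] is itself among
    those counted by [num_domains s]. *)
Lemma connection_gt0 s t : 0 < connection D s t <-> region D s `<=` dom t.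
Proof.
rewrite mxE; case: asboolP => [st|nst]; last by rewrite ltxx; split.
split=> // _; rewrite invr_gt0 ltr0n; apply/card_gt0P; exists (gam D t).
by rewrite inE; apply/asboolP.
Qed.

Lemma endpoint_idx (a : 'I_n.+1) :
  exists i : 'I_n, a = left_idx i \/ a = right_idx i.
Proof.
case: (unliftP ord0 a) => [i ->|->]; first by exists i; right.
by exists (Ordinal n_gt0); left; exact: val_inj.
Qed.

Lemma endpoint_region (i : 'I_n) a : a = left_idx i \/ a = right_idx i ->
  region D i (X a).
Proof.
by case=> ->; apply/regionP; rewrite !absc_mono !leqnn /= ?andbT leqnSn.
Qed.

Lemma mapL_region i u : dom i u -> region D i (mapL D i u).
Proof. by have [[/(_ u)]] := mapL_homeo hD i. Qed.

Lemma mapL_surj i x : region D i x -> exists2 u, dom i u & mapL D i u = x.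
Proof. by have [[_ _ /(_ x)]] := mapL_homeo hD i. Qed.

Lemma mapL_inj i u v : dom i u -> dom i v -> mapL D i u = mapL D i v -> u = v.
Proof.
have [[_ I _] _ _] := mapL_homeo hD i.
by move=> iu iv; apply: I; rewrite inE.
Qed.

(** * Agreement of the pieces at the data points *)

Definition interpolates (f : R -> R * R) := forall a, f (X a) = ordi D a.

(** By [mapL_endpoints] the node [X a] is the image of an endpoint of the domain; injectivity of
    [mapL D i] identifies that endpoint with [u], and the join-up condition gives the value. *)
Lemma mapF_endpoint f i u a : interpolates f ->
  dom i u -> a = left_idx i \/ a = right_idx i -> mapL D i u = X a ->
  mapF D i u (f u) = ordi D a.
Proof.
move=> fI iu ai ua.
have : [set X (left_idx i); X (right_idx i)] (X a).
  by case: ai => ->; [left|right].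
rewrite -(mapL_endpoints hD) => -[v ve va].
have [al [ale vE]] : exists al,
    (al = dom_start D (gam D i) \/ al = dom_end D (gam D i)) /\ v = X al.
  by case: ve => ->; eexists; (split; last reflexivity); [left|right].
have iv : dom i v.
  have se : (dom_start D (gam D i) <= dom_end D (gam D i))%N.
    by rewrite (leq_trans _ (dom_size hD _))// leq_addr.
  by rewrite vE; apply/domP; case: ale => ->; rewrite !absc_mono leqnn ?andbT.
have uv : u = X al.
  by rewrite -vE; apply: (@mapL_inj i) => //; rewrite ua va.
by rewrite uv fI; apply: (mapF_joinup hD) => //; rewrite -uv.
Qed.

(** This makes the Read-Bajraktarevic operator single-valued. For [i = j] injectivity gives [u = v].
    For [i < j] the common image is squeezed between the right node of region [i] and the left node
    of region [j], so these nodes coincide and both sides equal the datum there. *)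
Lemma mapF_consistent f i j u v : interpolates f ->
  dom i u -> dom j v -> mapL D i u = mapL D j v ->
  mapF D i u (f u) = mapF D j v (f v).
Proof.
move=> fI; wlog ij : i j u v / (i <= j)%N.
  move=> W iu jv uv; have [ij|/ltnW ji] := leqP i j; first exact: W.
  exact/esym/W.
move=> iu jv uv; move: ij; rewrite leq_eqVlt => /predU1P[/val_inj ijE|ij].
  by move: iu uv; rewrite ijE => iu uv; rewrite (mapL_inj iu jv uv).
have := mapL_region iu; rewrite uv => /regionP/andP[_ vr].
have /regionP/andP[lv _] := mapL_region jv.
have rl : X (right_idx i) <= X (left_idx j) by rewrite absc_mono.
have vl : mapL D j v = X (left_idx j).
  by apply/le_anti; rewrite lv (le_trans vr).
have vrE : mapL D j v = X (right_idx i).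
  by apply/le_anti; rewrite vr (le_trans rl).
rewrite (@mapF_endpoint f i u (right_idx i))//; [|by right|by rewrite uv].
rewrite (@mapF_endpoint f j v (left_idx j))//; last by left.
by congr (ordi D _); apply: absc_inj; rewrite -vl.
Qed.

(** * Contraction in the 1-norm of the plane *)

Definition norm1 (v : R * R) : R := `|v.1| + `|v.2|.

(** The bound by 1 makes the set of values bounded above, so that its [sup] is an upper bound. *)
Lemma max_abs_le (A : set R) (f : R -> R) t :
  A t -> (forall u, A u -> `|f u| < 1) -> `|f t| <= max_abs A f.
Proof.
move=> At f1; apply: ub_le_sup; last by exists t.
by exists 1 => _ [u Au <-]; exact/ltW/f1.
Qed.

Lemma Sbar_ge0 : 0 <= Sbar D.
Proof. exact: bigmax_ge_id. Qed.

(** [Sbar D] bounds both column sums of the absolute values of the scaling matrix, hence its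
    operator norm for the 1-norm; the terms [qmap] and [tqmap] cancel in the difference. *)
Lemma mapF_contract i u v w : dom i u ->
  norm1 (mapF D i u v - mapF D i u w) <= Sbar D * norm1 (v - w).
Proof.
move=> iu; have iLu := mapL_region iu; set x := mapL D i u in iLu.
have s1 t : region D i t -> `|scal D i t| < 1 by case/(scalings_lt1 hD).
have s2 t : region D i t -> `|scal' D i t| < 1 by case/(scalings_lt1 hD).
have s3 t : region D i t -> `|tscal D i t| < 1 by case/(scalings_lt1 hD).
have s4 t : region D i t -> `|tscal' D i t| < 1 by case/(scalings_lt1 hD).
have [c1 c2] : `|scal D i x| + `|tscal D i x| <= Sbar D /\
               `|scal' D i x| + `|tscal' D i x| <= Sbar D.
  have := @le_bigmax _ _ _ 0 (fun i : 'I_n =>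
    Num.max (max_abs (region D i) (scal D i) + max_abs (region D i) (tscal D i))
    (max_abs (region D i) (scal' D i) + max_abs (region D i) (tscal' D i))) i.
  rewrite ge_max => /andP[h1 h2]; split.
    by apply: le_trans h1; apply: lerD; exact: max_abs_le.
  by apply: le_trans h2; apply: lerD; exact: max_abs_le.
rewrite /norm1 /mapF -/x /=.
set a := scal D i x; set b := scal' D i x.
set c := tscal D i x; set d := tscal' D i x.
set p := v.1 - w.1; set q := v.2 - w.2.
have -> : a * v.1 + b * v.2 + qmap D i u - (a * w.1 + b * w.2 + qmap D i u) =
  a * p + b * q by rewrite /p /q; ring.
have -> : c * v.1 + d * v.2 + tqmap D i u - (c * w.1 + d * w.2 + tqmap D i u) =
  c * p + d * q by rewrite /p /q; ring.
have h1 := ler_normD (a * p) (b * q); have h2 := ler_normD (c * p) (d * q).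
rewrite !normrM in h1 h2.
have h3 : (`|a| + `|c|) * `|p| <= Sbar D * `|p| by exact: ler_wpM2r.
have h4 : (`|b| + `|d|) * `|q| <= Sbar D * `|q| by exact: ler_wpM2r.
lra.
Qed.

(** * The Read-Bajraktarevic operator *)

Definition continuous_interpolant (f : R -> R * R) :=
  {within whole D, continuous f} /\ interpolates f.

Lemma read_bajraktarevic_step f : continuous_interpolant f ->
  exists g, continuous_interpolant g /\
    forall i u, dom i u -> g (mapL D i u) = mapF D i u (f u).
Proof.
move=> [cf fI].
(* [P x] collects the values prescribed at [x] by all regions containing it; [mapF_consistent] shows
   that there is at most one. The default 0 is taken only outside the regions. *)
pose P x := [set v | exists i u,
  [/\ dom i u, mapL D i u = x & v = mapF D i u (f u)]].
pose g x := xget 0 (P x).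
have gE i u : dom i u -> g (mapL D i u) = mapF D i u (f u).
  move=> iu; rewrite /g; case: xgetP => [_ _ [j [v [jv vu ->]]]|].
    exact: mapF_consistent.
  by move=> /(_ (mapF D i u (f u))) []; exists i, u.
exists g; split => //; split; last first.
  move=> a; have [i ai] := endpoint_idx a.
  have [u iu ua] := mapL_surj (endpoint_region ai).
  by rewrite -ua gE//; exact: mapF_endpoint.
(* The regions form a finite closed cover, so continuity is checked on each one, where [g] is an
   expression in the continuous inverse [h] of [mapL D i], in [f] and in Lipschitz coefficients. *)
apply: (@continuous_subspaceW _ _ _ (\bigcup_i region D i)).
  by move=> x /whole_cover [s sx]; exists s.
apply: within_continuous_bigcup => i; first exact: interval_closed.
have [[_ _ iS] _ [h hK ch]] := mapL_homeo hD i.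
have rh x : region D i x -> dom i (h x) /\ mapL D i (h x) = x.
  by move=> /iS [u iu <-]; rewrite hK ?inE.
pose A := region D i.
have cfh : {within A, continuous (f \o h)}.
  apply: (@within_continuous_compW _ _ _ _ (whole D)) ch cf => x /rh[hx _].
  exact: domain_whole hx.
have [s1 s2 s3 s4] := scalings_lipschitz hD i.
have [q1 q2] := qmaps_lipschitz hD i.
have cqh (q : R -> R) :
    [lipschitz q t | t in dom i] -> {within A, continuous (q \o h)}.
  move=> /lipschitz_within_continuous.
  by apply: (@within_continuous_compW _ _ _ _ (dom i)) ch => x /rh[].
have caff (a b q : R -> R) :
    [lipschitz a t | t in A] -> [lipschitz b t | t in A] ->
    [lipschitz q t | t in dom i] ->
    {within A, continuous (fun x =>
      a x * (f (h x)).1 + b x * (f (h x)).2 + q (h x))}.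
  move=> /lipschitz_within_continuous ca /lipschitz_within_continuous cb /cqh cq.
  move=> x; apply: cvgD; last exact: cq.
  apply: cvgD; apply: cvgM; [exact: ca| |exact: cb|].
    exact: (within_continuous_fst cfh).
  exact: (within_continuous_snd cfh).
have caff12 := within_continuous_pair (caff _ _ _ s1 s2 q1) (caff _ _ _ s3 s4 q2).
apply: subspace_eq_continuous caff12.
move=> x; rewrite inE => /rh[hx Lhx].
have gx := gE _ _ hx; rewrite /mapF Lhx in gx.
exact: esym gx.
Qed.

Lemma continuous_interpolant_poly : exists f, continuous_interpolant f.
Proof.
have [p pE] := interpolating_poly (fun a => (ordi D a).1) absc_inj.
have [q qE] := interpolating_poly (fun a => (ordi D a).2) absc_inj.
exists (fun x => (p.[x], q.[x])); split; last first.
  by move=> a; rewrite /= pE qE; case: (ordi D a).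
by apply: within_continuous_pair; apply: continuous_subspaceT;
  exact: continuous_horner.
Qed.

Lemma read_bajraktarevic_iterates : exists F : nat -> R -> R * R,
  (forall m, continuous_interpolant (F m)) /\
  forall m i u, dom i u -> F m.+1 (mapL D i u) = mapF D i u (F m u).
Proof.
have [T TP] : exists T : (R -> R * R) -> (R -> R * R),
    forall f, continuous_interpolant f -> continuous_interpolant (T f) /\
      forall i u, dom i u -> T f (mapL D i u) = mapF D i u (f u).
  suff /choice[T TP] : forall f, exists g,
      continuous_interpolant f -> continuous_interpolant g /\
      forall i u, dom i u -> g (mapL D i u) = mapF D i u (f u) by exists T.
  move=> f.
  (* [choice] needs a value for every [f]; when [f] is not a continuous interpolant the requirement
     is vacuous and [f] itself serves. *)
  have [/read_bajraktarevic_step[g gP]|nf] := pselect (continuous_interpolant f).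
    by exists g.
  by exists f => /nf.
have [f0 f0g] := continuous_interpolant_poly.
have gF m : continuous_interpolant (iter m T f0) by elim: m => // m /TP[].
by exists (fun m => iter m T f0); split=> // m i u iu; exact: (TP _ (gF m)).2.
Qed.

Lemma bounded_whole (f : R -> R * R) : {within whole D, continuous f} ->
  exists M, forall x, whole D x -> norm1 (f x) <= M.
Proof.
move=> cf; have [M1 M1P] := within_continuous_bounded (within_continuous_fst cf).
have [M2 M2P] := within_continuous_bounded (within_continuous_snd cf).
by exists (M1 + M2) => x wx; apply: lerD; [exact: M1P|exact: M2P].
Qed.

(** * The fixed point of the operator *)

Lemma self_affine_interpolant : Sbar D < 1 -> exists f, continuous_interpolant f /\
  forall i u, dom i u -> f (mapL D i u) = mapF D i u (f u).
Proof.
move=> S1; have S0 := Sbar_ge0; set S := Sbar D in S1 S0.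
have [F [Fg FE]] := read_bajraktarevic_iterates.
have [K KP] : exists K, forall x, whole D x -> norm1 (F 1%N x - F 0%N x) <= K.
  apply: bounded_whole => x; apply: cvgB; [exact: (Fg 1%N).1|exact: (Fg 0%N).1].
(* A point of a region is pulled back by [mapL] to a point of a domain, again in the whole interval,
   which costs one factor [S]. *)
have inc m x : whole D x -> norm1 (F m.+1 x - F m x) <= K * S ^+ m.
  elim: m x => [|m ih] x wx; first by rewrite expr0 mulr1 KP.
  have [i ix] := whole_cover wx.
  have [u iu <-] := mapL_surj ix.
  rewrite !FE// (le_trans (mapF_contract _ _ iu))// exprS mulrCA.
  by apply: ler_wpM2l => //; apply: ih; exact: domain_whole iu.
have inc1 x : whole D x -> forall m, `|(F m.+1 x).1 - (F m x).1| <= K * S ^+ m.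
  by move=> wx m; apply: le_trans (inc m x wx); rewrite /norm1 lerDl.
have inc2 x : whole D x -> forall m, `|(F m.+1 x).2 - (F m x).2| <= K * S ^+ m.
  by move=> wx m; apply: le_trans (inc m x wx); rewrite /norm1 lerDr.
pose f x := (limn (fun m => (F m x).1), limn (fun m => (F m x).2)).
have lim1 x (wx : whole D x) :=
  geometric_increments_limit (u := fun m => (F m x).1) S0 S1 (inc1 x wx).
have lim2 x (wx : whole D x) :=
  geometric_increments_limit (u := fun m => (F m x).2) S0 S1 (inc2 x wx).
have small e : 0 < e -> exists m, K / (1 - S) * S ^+ m <= e.
  move=> e0.
  have /cvgrPdist_le/(_ _ e0) : geometric (K / (1 - S)) S @ \oo --> (0 : R).
    by apply: cvg_geometric; rewrite ger0_norm.
  move=> [N _ /(_ N (leqnn N))]; rewrite /= sub0r normrN => KN.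
  by exists N; apply: le_trans KN; exact: ler_norm.
have cf : {within whole D, continuous f}.
  apply: within_continuous_pair.
    apply: (within_continuous_uniform_limit (u := fun m x => (F m x).1)) => [m|e].
      exact: within_continuous_fst (Fg m).1.
    move=> /small[m me]; exists m => x wx; apply: le_trans me.
    exact: (lim1 x wx).2.
  apply: (within_continuous_uniform_limit (u := fun m x => (F m x).2)) => [m|e].
    exact: within_continuous_snd (Fg m).1.
  move=> /small[m me]; exists m => x wx; apply: le_trans me.
  exact: (lim2 x wx).2.
exists f; split; first split => //.
(* At a node every iterate takes the data value, so the sequences are constant. *)
- move=> a; rewrite /f; under eq_fun do rewrite (Fg _).2.
  under [X in (_, limn X)]eq_fun do rewrite (Fg _).2.
  by rewrite !lim_cst//; case: (ordi D a).
(* The self-affine equation is the limit of the recursion for [F m.+1]: at fixed [u] the map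
   [mapF D i u] is affine, and shifting the index leaves the limit unchanged. *)
- move=> i u iu; have wu := domain_whole iu.
  have wL : whole D (mapL D i u) by apply/region_whole/mapL_region.
  have c1 : (F m u).1 @[m --> \oo] --> (f u).1 := (lim1 u wu).1.
  have c2 : (F m u).2 @[m --> \oo] --> (f u).2 := (lim2 u wu).1.
  have caff (a b q : R) : a * (F m u).1 + b * (F m u).2 + q @[m --> \oo] -->
      a * (f u).1 + b * (f u).2 + q.
    apply: cvgD; last exact: cvg_cst.
    by apply: cvgD; apply: cvgM => //; exact: cvg_cst.
  have limS (v : nat -> R) (y : R) : v m.+1 @[m --> \oo] --> y -> limn v = y.
    by rewrite cvg_shiftS => vy; exact: cvg_lim.
  rewrite /f /mapF /=; congr (_, _); apply: limS.
    by under eq_fun do rewrite FE//; exact: caff.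
  by under eq_fun do rewrite FE//; exact: caff.
Qed.

(** * Uniqueness of the invariant tuple and the attractor *)

Lemma mapL_uniform_contraction : exists2 c : R, 0 <= c < 1 &
  forall i u v, dom i u -> dom i v ->
    `|mapL D i u - mapL D i v| <= c * `|u - v|.
Proof.
have /choice[c cP] : forall i, exists c : R, c < 1 /\
    forall u v, dom i u -> dom i v -> `|mapL D i u - mapL D i v| <= c * `|u - v|.
  move=> i; have [c c1 cL] := mapL_contraction hD i.
  by exists c; split=> // u v iu iv; exact: (cL (u, v) (conj iu iv)).
(* Starting the maximum at 0 makes the common ratio nonnegative, whatever the signs of the
   individual constants. *)
exists (\big[Num.max/0]_i c i).
  by rewrite bigmax_ge_id; apply: bigmax_lt => // i _; exact: (cP i).1.
move=> i u v iu iv; apply: le_trans ((cP i).2 _ _ iu iv) _.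
by apply: ler_wpM2r => //; exact: le_bigmax.
Qed.

Section Attractor.
Context (f : R -> R * R) (cf : {within whole D, continuous f}).
Context (fE : forall i u, dom i u -> f (mapL D i u) = mapF D i u (f u)).

Let G t := graph_on (region D t) f.

Lemma graph_compact t : compact (G t).
Proof.
apply: continuous_compact; last exact: segment_compact.
apply: within_continuous_pair.
  by apply: continuous_subspaceT => x; exact: cvg_id.
exact: continuous_subspaceW (region_whole (i := t)) cf.
Qed.

(** The equation [fE] says that [mapW D t] carries graph points to graph points. Every point over
    region [t] is reached because [mapL D t] is onto and [dom t] is a union of regions, all
    connected to [t]. *)
Lemma graph_invariant : invariant_tuple D G.
Proof.
move=> t; split.
- exists (X (left_idx t), f (X (left_idx t))); exists (X (left_idx t)) => //.
  by apply: endpoint_region => //; left.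
- exact: graph_compact.
- by move=> _ [x tx <-].
- apply/seteqP; split=> [_ [x tx <-]|_ [s /= /connection_gt0 st [_ [u su <-] <-]]].
    have [u iu ux] := mapL_surj tx.
    have [s st su] := domain_cover iu.
    exists s; first exact/connection_gt0.
    by exists (u, f u); [exists u|rewrite /mapW /= -fE// ux].
  have iu := st _ su; exists (mapL D t u); first exact: mapL_region.
  by rewrite /mapW /= fE.
Qed.

Lemma invariant_bounded A : invariant_tuple D A ->
  exists E, forall t p, A t p -> norm1 (p.2 - f p.1) <= E.
Proof.
move=> AI; have [M MP] := bounded_whole cf.
have /choice[N NP] : forall t, exists N, forall p, A t p -> norm1 p.2 <= N.
  move=> t; have [_ /compact_bounded[N [_ NP]] _ _] := AI t.
  (* The norm on a product is the maximum norm, so each of the two coordinates of [p.2] is at most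
     [N + 1]. *)
  exists (N + 1 + (N + 1)) => p tp.
  have := NP (N + 1); rewrite ltrDl ltr01 => /(_ isT p tp) pN.
  have h : `|p.2| <= N + 1.
    by apply: le_trans pN; rewrite prod_normE le_max lexx orbT.
  by apply: lerD; apply: le_trans h; rewrite prod_normE le_max lexx ?orbT.
exists (\big[Num.max/0]_t N t + M) => t p tp.
have [_ _ /(_ _ tp) [tp1 _] _] := AI t.
have h1 := NP t p tp; have h2 := MP _ (region_whole tp1).
have h3 := @le_bigmax _ _ _ 0 N t.
apply: le_trans (lerD (le_trans h1 h3) h2).
rewrite /norm1 /=; have := ler_normB p.2.1 (f p.1).1.
have := ler_normB p.2.2 (f p.1).2; lra.
Qed.

Lemma norm1_le0 (v w : R * R) : norm1 (v - w) <= 0 -> v = w.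
Proof.
case: v w => [a b] [c d]; rewrite /norm1 /= => h.
have := normr_ge0 (a - c); have := normr_ge0 (b - d) => bd ac.
have /eqP : `|a - c| = 0 by apply/le_anti; lra.
have /eqP : `|b - d| = 0 by apply/le_anti; lra.
by rewrite !normr_eq0 !subr_eq0 => /eqP -> /eqP ->.
Qed.

Lemma invariant_sub_graph A : Sbar D < 1 -> invariant_tuple D A ->
  forall t, A t `<=` G t.
Proof.
move=> S1 AI; have S0 := Sbar_ge0; have [E EP] := invariant_bounded AI.
(* By invariance [p] is the image of some [q] in a connected [A s]; as the graph is carried to
   itself, the vertical distance at [q] is multiplied by at most [Sbar D]. *)
have dist m : forall t p, A t p -> norm1 (p.2 - f p.1) <= Sbar D ^+ m * E.
  elim: m => [|m ih] t p; first by rewrite expr0 mul1r; exact: EP.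
  have [_ _ _ ->] := AI t; move=> [s /= /connection_gt0 st [q sq <-]] /=.
  have iq : dom t q.1 by apply: st; have [_ _ /(_ _ sq) []] := AI s.
  rewrite fE// (le_trans (mapF_contract _ _ iq))// exprS -mulrA.
  by apply: ler_wpM2l => //; exact: ih sq.
move=> t p tp; have [_ _ /(_ _ tp) [tp1 _] _] := AI t.
exists p.1 => //; rewrite [RHS]surjective_pairing; congr (_, _).
apply/esym/norm1_le0; apply: (@ger0_geometric_le0 _ _ (Sbar D) E) => // m.
exact: dist tp.
Qed.

Lemma invariant_proj A : invariant_tuple D A ->
  forall t, region D t `<=` fst @` A t.
Proof.
move=> AI; have [c /andP[c0 c1] cL] := mapL_uniform_contraction.
pose W := X ord_max - X ord0.
(* For [m = 0] any point of [A t] will do, [W] being the length of the whole interval. For the step,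
   [x] is pulled back to [u] in [dom t], a nearby point is found over a region of that domain
   containing [u], and [mapW D t] pushes it forward. *)
have near m : forall t x, region D t x ->
    exists2 p, A t p & `|x - p.1| <= c ^+ m * W.
  elim: m => [|m ih] t x tx.
    have [[p tp] _ /(_ _ tp) [tp1 _] _] := AI t.
    exists p => //; rewrite expr0 mul1r /W.
    move: (region_whole tx) (region_whole tp1).
    move=> /wholeP/andP[? ?] /wholeP/andP[? ?].
    by rewrite ler_norml; apply/andP; split; lra.
  have [u iu <-] := mapL_surj tx.
  have [s st su] := domain_cover iu.
  have [p sp up] := ih _ _ su; exists (mapW D t p).
    have [_ _ _ ->] := AI t; exists s; first exact/connection_gt0.
    by exists p.
  have ip : dom t p.1 by apply: st; have [_ _ /(_ _ sp) []] := AI s.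
  rewrite (le_trans (cL _ _ _ iu ip))// exprS -mulrA.
  exact: ler_wpM2l.
move=> t x tx; have [_ At _ _] := AI t.
(* A compact projection is closed, so approximating [x] by its points is enough. *)
have clA : closed (fst @` A t).
  apply: compact_closed; first exact: Rhausdorff.
  apply: continuous_compact At; apply: continuous_subspaceT => p.
  exact: cvg_fst.
rewrite closure_id in clA; rewrite clA => B /nbhs_ballP[e /= e0 eB].
have [m me] : exists m, c ^+ m * W < e.
  have /cvgrPdist_lt/(_ _ e0) : geometric W c @ \oo --> (0 : R).
    by apply: cvg_geometric; rewrite ger0_norm.
  move=> [m _ /(_ m (leqnn m))]; rewrite /= sub0r normrN => h.
  by exists m; rewrite mulrC; apply: le_lt_trans h; exact: ler_norm.
have [p tp xp] := near m t x tx.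
by exists p.1; split; [exists p|apply: eB; apply: le_lt_trans me].
Qed.

Lemma attractor_graph : Sbar D < 1 -> attractor D = graph_on (whole D) f.
Proof.
move=> S1.
have uG A : invariant_tuple D A -> A = G.
  move=> AI; apply/funext => t; apply/seteqP; split.
    exact: invariant_sub_graph.
  (* Some point of [A t] lies above [x], and being on the graph it must be [(x, f x)]. *)
  move=> _ [x tx <-]; have [p tp px] := invariant_proj AI tx.
  have [y ty yp] := invariant_sub_graph S1 AI tp.
  by rewrite -px -yp /= yp.
have tG : attractor_tuple D = G.
  (* The default of [xget] is excluded because [G] is itself the unique invariant tuple. *)
  rewrite /attractor_tuple; case: xgetP => [A _ [/uG //]|/(_ G) []].
  by split; [exact: graph_invariant|move=> A /uG].
rewrite /attractor tG; apply/seteqP; split.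
  by move=> _ [t _ [x tx <-]]; exists x => //; exact: region_whole tx.
move=> _ [x wx <-]; have [t tx] := whole_cover wx.
by exists t => //; exists x.
Qed.

End Attractor.
End RecurrentFractalInterpolation.

Theorem theorem2 (R : realType) (n l : nat) (D : rfif_data R n l)
    (hD : rfif_hyps D) (hS : Sbar D < 1) :
  exists f : R -> R * R,
    [/\ {within whole D, continuous f},
        forall i : 'I_n.+1, f (absc D i) = ordi D i &
        graph_on (whole D) f = attractor D].
Proof.
have [f [[cf fI] fE]] := self_affine_interpolant hD hS.
by exists f; split=> //; rewrite (attractor_graph hD cf fE hS).
Qed.
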